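(* Let $w\in MW(\mathfrak{G})$, and let $S(w)=Aw\delta=(b_1,b_2,\dots,b_n)$, an $n$-tuple of positive and negative integers. Let $i_1<i_2<\dots<i_m$ be the values of the index $i$ for which $b_i$ is negative. Then $s_{i_1},s_{i_2},\dots,s_{i_m}$ are exactly the simple reflections that can be the first element of a reduced expression of $w$ (these can be, and they are the only ones).
   Context: Let $\mathfrak{G}$ be a complex semisimple Lie algebra of rank $n$, with a fixed Cartan subalgebra, root system $\Delta$, positive roots $\Delta^+$, simple roots $\alpha_1,\dots,\alpha_n$, and Cartan matrix $A=(a_{ij})$. Identify $\alpha_i$ with the standard basis vector $e_i$ of $\mathbb{R}^n$, so that $\Delta\subset\mathbb{R}^n$, and equip $\mathbb{R}^n$ with a (positive definite) inner product $\langle\cdot,\cdot\rangle$ such that $2\langle e_i,e_j\rangle/\langle e_i,e_i\rangle=a_{ij}$ for all $i,j$. Let $\delta\in\mathbb{R}^n$ be the half-sum of all positive roots. $MW(\mathfrak{G})$ denotes the Weyl group of $\mathfrak{G}$ realized as a group of $n\times n$ (integer) matrices with respect to the basis of simple roots, acting on $\mathbb{R}^n$; $s_i$ is the simple reflection corresponding to $\alpha_i$. A reduced expression of $w$ is a shortest possible expression $w=s_{j_1}s_{j_2}\cdots s_{j_l}$ as a product of simple reflections; its first element is $s_{j_1}$ (the leftmost factor). *)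

(* Defs.v *)
From HB Require Import structures.
From mathcomp Require Import all_boot all_order all_algebra.
From mathcomp Require Import complex.
From mathcomp Require Import boolp classical_sets fsbigop reals.

Set Implicit Arguments.
Unset Strict Implicit.
Unset Printing Implicit Defensive.

Import Order.TTheory GRing.Theory Num.Theory.

Local Open Scope ring_scope.
Local Open Scope complex_scope.
Local Open Scope classical_set_scope.

Record lieAlgebra (K : fieldType) := LieAlgebra {
  lie_space :> vectType K;
  bracket : lie_space -> lie_space -> lie_space;
  bracket_linear_l : forall (c : K) (x y z : lie_space),
    bracket (c *: x + y) z = c *: bracket x z + bracket y z;
  bracket_linear_r : forall (c : K) (x y z : lie_space),
    bracket z (c *: x + y) = c *: bracket z x + bracket z y;
  bracket_alt : forall x : lie_space, bracket x x = 0;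
  bracket_jacobi : forall x y z : lie_space,
    bracket x (bracket y z) + bracket y (bracket z x)
      + bracket z (bracket x y) = 0
}.

Section LieAlgebra.
Context (K : fieldType) (L : lieAlgebra K).
Implicit Types (U V I H : {vspace L}).

Definition lie_prod U V : {vspace L} :=
  (<<[seq bracket x y | x <- vbasis U, y <- vbasis V]>>)%VS.

Definition derived_series (k : nat) U : {vspace L} :=
  iter k (fun V => lie_prod V V) U.

Definition lie_solvable U : Prop := exists k, derived_series k U = 0%VS.

Definition lie_ideal I : Prop :=
  forall x y : L, y \in I -> bracket x y \in I.

Definition semisimple : Prop :=
  forall I, lie_ideal I -> lie_solvable I -> I = 0%VS.

Definition lie_abelian U : Prop :=
  forall x y : L, x \in U -> y \in U -> bracket x y = 0.

Definition ad_diagonalizable (h : L) : Prop :=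
  exists b : seq L, basis_of fullv b /\
    forall x, x \in b -> exists c : K, bracket h x = c *: x.

(* The usual definition for semisimple L over an algebraically closed field:
   a maximal abelian subalgebra H with ad h semisimple for all h in H
   (an abelian subspace is automatically a subalgebra). *)
Record cartan_subalgebra H : Prop := CartanSubalgebra {
  cartan_abelian : lie_abelian H;
  cartan_maximal : forall H', lie_abelian H' -> (H <= H')%VS -> H' = H;
  cartan_diag : forall h, h \in H -> ad_diagonalizable h
}.

(* The dual space of H. *)
Definition lie_dual H := 'Hom(subvs_of H, K^o).

Definition in_root_space H (a : lie_dual H) (x : L) : Prop :=
  forall h : subvs_of H, bracket (vsval h) x = a h *: x.

Definition is_root H (a : lie_dual H) : Prop :=
  a != 0 /\ exists2 x : L, x != 0 & in_root_space a x.

(* [L_a, L_(-a)] is one-dimensional for semisimple L, so h is unique and single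
   brackets suffice. *)
Definition is_coroot H (a : lie_dual H) (h : subvs_of H) : Prop :=
  (exists x y : L, [/\ in_root_space a x, in_root_space (- a) y
                     & vsval h = bracket x y]) /\ a h = 2.

Definition simple_roots H (n : nat) (alpha : 'I_n -> lie_dual H) : Prop :=
  [/\ basis_of fullv (codom alpha),
      forall i, is_root (alpha i)
    & forall b : lie_dual H, is_root b -> exists k : 'I_n -> nat,
        b = \sum_i alpha i *+ k i \/ b = - \sum_i alpha i *+ k i].

(* a_ij = <alpha_j, alpha_i^vee>. *)
Definition cartan_matrix H (n : nat) (alpha : 'I_n -> lie_dual H)
    (A : 'M[K]_n) : Prop :=
  exists h : 'I_n -> subvs_of H,
    (forall i, is_coroot (alpha i) (h i)) /\
    (forall i j, A i j = alpha j (h i)).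

End LieAlgebra.

Section Coordinates.
Context (R : realType) (n : nat).

Definition e_ (i : 'I_n) : 'cV[R]_n := delta_mx i 0.

(* The root system as a subset of R^n: alpha_i is identified with e_i. *)
Definition root_set (L : lieAlgebra R[i]) (H : {vspace L})
    (alpha : 'I_n -> lie_dual H) : set 'cV[R]_n :=
  [set v | is_root (\sum_i (v i 0)%:C *: alpha i)].

Definition positive_roots (L : lieAlgebra R[i]) (H : {vspace L})
    (alpha : 'I_n -> lie_dual H) : set 'cV[R]_n :=
  [set v | root_set alpha v /\ forall i, 0 <= v i 0].

Definition half_sum_positive_roots (L : lieAlgebra R[i]) (H : {vspace L})
    (alpha : 'I_n -> lie_dual H) : 'cV[R]_n :=
  2^-1 *: \sum_(v \in positive_roots alpha) v.

Record inner_product (ip : 'cV[R]_n -> 'cV[R]_n -> R) : Prop := InnerProduct {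
  ip_linear : forall (c : R) (x y z : 'cV[R]_n),
    ip (c *: x + y) z = c * ip x z + ip y z;
  ip_sym : forall x y : 'cV[R]_n, ip x y = ip y x;
  ip_pos : forall x : 'cV[R]_n, x != 0 -> 0 < ip x x
}.

(* Matrix of v |-> v - 2 <v, a> / <a, a> a, acting on column vectors. *)
Definition reflection_mx (ip : 'cV[R]_n -> 'cV[R]_n -> R)
    (a : 'cV[R]_n) : 'M[R]_n :=
  \matrix_(k, j) ((e_ j - (2 * ip (e_ j) a / ip a a) *: a) k 0).

(* The group generated by the reflections in all the elements of D; products
   suffice, since reflections are their own inverses. *)
Definition weyl_group (ip : 'cV[R]_n -> 'cV[R]_n -> R) (D : set 'cV[R]_n) :
    set 'M[R]_n :=
  [set w | exists s : seq 'cV[R]_n,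
     (forall a, a \in s -> D a) /\ w = \prod_(a <- s) reflection_mx ip a].

Definition simple_reflection (ip : 'cV[R]_n -> 'cV[R]_n -> R) (i : 'I_n) :
    'M[R]_n :=
  reflection_mx ip (e_ i).

Definition word_prod (ip : 'cV[R]_n -> 'cV[R]_n -> R) (s : seq 'I_n) :
    'M[R]_n :=
  \prod_(j <- s) simple_reflection ip j.

Definition reduced_expression (ip : 'cV[R]_n -> 'cV[R]_n -> R)
    (w : 'M[R]_n) (s : seq 'I_n) : Prop :=
  w = word_prod ip s /\
  forall t : seq 'I_n, w = word_prod ip t -> (size s <= size t)%N.

End Coordinates.

(* Main.v *)
Require Import Defs.
From mathcomp Require Import all_boot all_order all_algebra.
From mathcomp Require Import complex.
From mathcomp Require Import boolp classical_sets reals.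
From mathcomp Require Import cardinality fsbigop.
From mathcomp Require Import ring zify.

(** The number b_i is a positive multiple of <w^-1 alpha_i, delta>.  Since
    s_i delta = delta - alpha_i, the vector delta pairs to 1 with every simple
    coroot, hence positively with every positive root.  So b_i is never 0, and
    it is negative exactly when the root w^-1 alpha_i is negative.  It is an
    integer because A delta = (1, ..., 1) and s_j changes A v by an integral
    multiple of a column of the integral matrix A.

    It remains to see that w^-1 alpha_i < 0 exactly when some reduced word of w
    starts with s_i.  This is the exchange property ([exchange]): along a word
    s_j1 ... s_jl of w, the roots alpha_i, s_j1 alpha_i, s_j2 s_j1 alpha_i, ...
    must change sign at some letter s_j, which can happen only at alpha_j
    ([simple_reflection_nonneg]); then s_i w is the same word with that letter
    erased.

    These arguments use the following about the set of roots, collected in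
    [based_root_system]: it is finite, every root has natural coordinates up
    to a global sign, simple reflections permute the roots, no multiple
    k alpha_i with k > 1 is a root, and A is integral.  The first comes from
    the simultaneous diagonalizability of ad H, the second is the definition of
    simple roots, and the others come from sl2-theory.  The given coroot h of a
    root a is a bracket [x, y] with x, y of weights a, -a and a(h) = 2, so
    x, y, h is an sl2-triple, and no property of the Killing form enters.  Every
    root vector v of weight b is pushed by ad x to a highest weight vector; the
    ad y-string below that has weights N, N-2, ..., -N under h ([sl2_string]),
    which makes b(h) an integer and shows that -b(h) is again a weight of the
    string, that is, b - b(h) a is a root ([root_reflection]).  Proper multiples
    are excluded by [root_not_multiple].

    Finally the group generated by all reflections is the one generated by the
    simple ones, since every root is up to sign a simple root moved by a product
    of simple reflections ([nonneg_root_conj], by induction on the height). *)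

Set Implicit Arguments.
Unset Strict Implicit.
Unset Printing Implicit Defensive.

Import Order.TTheory GRing.Theory Num.Theory.
Local Open Scope ring_scope.
Local Open Scope complex_scope.

(** * Brackets and ad-diagonalizable elements *)

Section Bracket.
Context (K : fieldType) (L : lieAlgebra K).
Implicit Types x y z v : L.

Lemma bracketDl x y z : bracket (x + y) z = bracket x z + bracket y z.
Proof. by rewrite -[x]scale1r bracket_linear_l !scale1r. Qed.

Lemma bracketDr x y z : bracket z (x + y) = bracket z x + bracket z y.
Proof. by rewrite -[x]scale1r bracket_linear_r !scale1r. Qed.

Lemma bracket0l z : bracket 0 z = 0 :> L.
Proof. by apply: (addrI (bracket 0 z)); rewrite -bracketDl !addr0. Qed.

Lemma bracket0r z : bracket z 0 = 0 :> L.
Proof. by apply: (addrI (bracket z 0)); rewrite -bracketDr !addr0. Qed.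

Lemma bracketZl c x z : bracket (c *: x) z = c *: bracket x z.
Proof. by rewrite -[c *: x]addr0 bracket_linear_l bracket0l addr0. Qed.

Lemma bracketZr c x z : bracket z (c *: x) = c *: bracket z x.
Proof. by rewrite -[c *: x]addr0 bracket_linear_r bracket0r addr0. Qed.

Lemma bracketC x y : bracket x y = - bracket y x.
Proof.
apply/eqP; rewrite -addr_eq0; apply/eqP.
have := bracket_alt (x + y).
by rewrite bracketDl !bracketDr !bracket_alt add0r addr0.
Qed.

Lemma bracketNr x z : bracket z (- x) = - bracket z x.
Proof. by rewrite -scaleN1r bracketZr scaleN1r. Qed.

Lemma bracket_sumr (I : Type) (r : seq I) (F : I -> L) z :
  bracket z (\sum_(i <- r) F i) = \sum_(i <- r) bracket z (F i).
Proof. exact: (big_morph _ (fun x y => bracketDr x y z) (bracket0r z)). Qed.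

Lemma bracket_derivation z x y :
  bracket z (bracket x y) = bracket (bracket z x) y + bracket x (bracket z y).
Proof.
apply/eqP; rewrite -subr_eq0 opprD addrA -[bracket (bracket z x) y]opprK.
rewrite -bracketC opprK -bracketNr -bracketC addrAC.
by rewrite -(bracket_jacobi z x y) addrAC.
Qed.

(** In an eigenbasis of ad h, an eigenvector has a nonzero coordinate along some
    basis vector, and the two eigenvalues must agree. *)
Lemma eigenvalues_finite (h : L) : ad_diagonalizable h ->
  exists E : seq K, forall c v, v != 0 -> bracket h v = c *: v -> c \in E.
Proof.
case=> b [b_basis b_eigen].
have /choice[e eP] : forall x, exists c, x \in b -> bracket h x = c *: x.
  move=> x; case: (boolP (x \in b)) => [/b_eigen[c xc]|_]; first by exists c.
  by exists 0.
exists [seq e x | x <- b] => c v v0 vc.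
have vE := coord_basis (X := in_tuple b) b_basis (memvf v).
have b_free : free (in_tuple b) := basis_free b_basis.
have [i vi] : exists i, coord (in_tuple b) i v != 0.
  apply/existsP; apply: contraNT v0 => /existsPn v_i.
  by rewrite vE big1 // => i _; move/negPn/eqP: (v_i i) => ->; rewrite scale0r.
have bi : b`_i \in b by rewrite mem_nth.
suff <- : e b`_i = c by apply: map_f.
apply: (mulfI vi); rewrite [RHS]mulrC.
have := congr1 (coord (in_tuple b) i) vc.
rewrite linearZ /= => <-.
rewrite [in RHS]vE bracket_sumr.
rewrite -(coord_sum_free (fun j => coord (in_tuple b) j v * e b`_j) i b_free).
congr (coord _ _ _); apply: eq_bigr => j _.
by rewrite bracketZr eP ?mem_nth // scalerA.
Qed.

End Bracket.

(** * Strings of an sl2-triple *)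

Section SL2.
Context (K : numFieldType) (L : lieAlgebra K).
Implicit Types x y h u v : L.

Definition ad_iter x k v : L := iter k (bracket x) v.

Lemma ad_iter_weight h x v (d c : K) k :
    bracket h x = d *: x -> bracket h v = c *: v ->
  bracket h (ad_iter x k v) = (c + d * k%:R) *: ad_iter x k v.
Proof.
move=> hx hv; elim: k => [|k IHk]; first by rewrite mulr0 addr0.
rewrite /= -/(ad_iter x k v) bracket_derivation hx IHk bracketZl bracketZr.
by rewrite -scalerDl -natr1; congr (_ *: _); ring.
Qed.

(** The vectors (ad x)^k v have the pairwise distinct weights c + d k, of which
    only finitely many are eigenvalues of ad h. *)
Lemma ad_iter_nilpotent h x v (d c : K) : ad_diagonalizable h ->
    d != 0 -> bracket h x = d *: x -> bracket h v = c *: v -> v != 0 ->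
  exists p, ad_iter x p v != 0 /\ ad_iter x p.+1 v = 0.
Proof.
move=> /eigenvalues_finite[E EP] d0 hx hv v0.
suff [k k0] : exists k, ad_iter x k v == 0.
  have ex0 : exists k, ad_iter x k v == 0 by exists k.
  case: (ex_minnP ex0) => -[|p] /eqP p0 p_min; first by rewrite -p0 eqxx in v0.
  exists p; split=> //; apply/negP => /p_min; by rewrite ltnn.
apply: contrapT => /forallNP all0.
(* one weight more than there are eigenvalues *)
pose W := [seq c + d * k%:R | k <- iota 0 (size E).+1].
have W_uniq : uniq W.
  rewrite map_inj_uniq ?iota_uniq // => i j /addrI /(mulfI d0) /eqP.
  by rewrite eqr_nat => /eqP.
have /(uniq_leq_size W_uniq) : {subset W <= E}.
  move=> _ /mapP[k _ ->]; apply: (EP _ (ad_iter x k v)); first exact/negP/all0.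
  exact: ad_iter_weight.
by rewrite size_map size_iota ltnn.
Qed.

(** Take p maximal with u = (ad x)^p v nonzero: u is a highest weight vector, of
    weight m = c + 2 p, so that x y^(j+1) u = (j+1) (m - j) y^j u.  If q is the
    last exponent with y^q u nonzero, this relation at j = q gives m = q. *)
Lemma sl2_string x y h v (c : K) :
    bracket x y = h -> bracket h x = 2 *: x -> bracket h y = - 2 *: y ->
    ad_diagonalizable h -> v != 0 -> bracket h v = c *: v ->
  exists (p N : nat), [/\ c + 2 * p%:R = N%:R,
    forall j, (j <= N)%N -> ad_iter y j (ad_iter x p v) != 0
  & forall j, bracket x (ad_iter y j.+1 (ad_iter x p v)) =
      (j.+1%:R * (N%:R - j%:R)) *: ad_iter y j (ad_iter x p v)].
Proof.
move=> xy hx hy h_diag v0 hv.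
have n2 : (2 : K) != 0 by rewrite pnatr_eq0.
have [p [u0 xu]] := ad_iter_nilpotent h_diag n2 hx hv v0.
have hu := ad_iter_weight p hx hv.
set u := ad_iter x p v in u0 xu hu *.
set m := c + 2 * p%:R in hu.
have xyu j : bracket x (ad_iter y j.+1 u) =
    (j.+1%:R * (m - j%:R)) *: ad_iter y j u.
  elim: j => [|j IHj].
    rewrite /= bracket_derivation xy [bracket x u]xu bracket0r addr0 hu.
    by rewrite mul1r subr0.
  rewrite [LHS]/= bracket_derivation xy -[bracket y _]/(ad_iter y j.+1 u) IHj.
  rewrite (ad_iter_weight j.+1 hy hu) bracketZr -scalerDl.
  by congr (_ *: _); rewrite -!natr1; ring.
have [|q [yq0 yq]] := ad_iter_nilpotent h_diag _ hy hu u0.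
  by rewrite oppr_eq0.
have mq : m = q%:R.
  have := xyu q; rewrite yq bracket0r => /esym/eqP.
  by rewrite scaler_eq0 (negPf yq0) orbF mulf_eq0 pnatr_eq0 /= subr_eq0 => /eqP.
exists p, q; split => // [j jq|j]; last by rewrite xyu mq.
apply: contra yq0 => /eqP yj0.
rewrite -(subnK jq) /ad_iter iterD -/(ad_iter y j u) yj0 -/(ad_iter _ _ _).
by apply/eqP; elim: (q - j)%N => //= k ->; rewrite bracket0r.
Qed.

End SL2.

(** * Roots of a semisimple Lie algebra *)

Section RootSpaces.
Context (K : numFieldType) (L : lieAlgebra K) (H : {vspace L}).
Hypothesis H_cartan : cartan_subalgebra H.
Implicit Types (a b : lie_dual H) (h : subvs_of H) (x y v : L).

Lemma root_space_bracket a b x y :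
  in_root_space a x -> in_root_space b y -> in_root_space (a + b) (bracket x y).
Proof.
move=> ax bY h; rewrite bracket_derivation ax bY bracketZl bracketZr -scalerDl.
by rewrite add_lfunE.
Qed.

Lemma root_space_ad_iter a b x v k :
  in_root_space a x -> in_root_space b v ->
  in_root_space (b + a *+ k) (ad_iter x k v).
Proof.
move=> ax bv; elim: k => [|k IHk]; first by rewrite mulr0n addr0.
by rewrite mulrS addrCA; exact: root_space_bracket.
Qed.

(** An element centralizing H spans with H an abelian subspace, so it lies in H
    by maximality. *)
Lemma root_space0 x : in_root_space (0 : lie_dual H) x -> x \in H.
Proof.
move=> x0.
have xC z : z \in H -> bracket z x = 0.
  by move=> zH; have := x0 (Subvs zH); rewrite zero_lfunE scale0r.
have <- : (H + <[x]>)%VS = H; last by rewrite (subvP (addvSr _ _)) ?memv_line.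
apply: cartan_maximal H_cartan _ _ (addvSl _ _).
move=> y z /memv_addP[u uH [_ /vlineP[c ->] ->]].
move=> /memv_addP[v vH [_ /vlineP[d ->] ->]].
rewrite bracketDl !bracketDr !bracketZl !bracketZr bracket_alt.
rewrite (cartan_abelian H_cartan uH vH) xC // [bracket x v]bracketC xC //.
by rewrite oppr0 !scaler0 !addr0.
Qed.

Lemma is_corootN a h : is_coroot a h -> is_coroot (- a) (- h).
Proof.
move=> [[x [y [ax ay hE]]] ah]; split; last by rewrite opp_lfunE linearN opprK.
exists y, x; split=> //; first by rewrite opprK.
by rewrite raddfN /= hE -bracketC.
Qed.

(** The string of [sl2_string], for the triple behind a coroot, with the weights
    of its members recorded as functionals on H: u 0 is the highest weight
    vector above v, and u j is obtained from it by lowering j times. *)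
Lemma root_string a b h v : is_coroot a h -> v != 0 -> in_root_space b v ->
  exists (x : L) (p N : nat) (u : nat -> L),
  [/\ in_root_space a x,
      b h + 2 * p%:R = N%:R,
      forall j, in_root_space (b + a *+ p - a *+ j) (u j),
      forall j, (j <= N)%N -> u j != 0
    & forall j, bracket x (u j.+1) = (j.+1%:R * (N%:R - j%:R)) *: u j].
Proof.
move=> [[x [y [ax ay hE]]] ah] v0 bv.
have hx : bracket (vsval h) x = 2 *: x by rewrite ax ah.
have hy : bracket (vsval h) y = - 2 *: y by rewrite ay opp_lfunE ah.
have h_diag := cartan_diag H_cartan (subvsP h).
have [p [N [cN u0 xu]]] := sl2_string (esym hE) hx hy h_diag v0 (bv h).
exists x, p, N, (fun j => ad_iter y j (ad_iter x p v)); split=> // j.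
by rewrite -mulNrn; exact/(root_space_ad_iter _ ay)/root_space_ad_iter.
Qed.

Lemma root_coroot_int a b h : is_coroot a h -> is_root b ->
  exists z : int, b h = z%:~R.
Proof.
move=> ah [_ [v v0 bv]].
have [x [p [N [u [_ cN _ _ _]]]]] := root_string ah v0 bv.
exists (N%:Z - 2 * p%:Z); rewrite intrB intrM !pmulrn in cN *.
by rewrite -cN addrK.
Qed.

(** With b(h) = c >= 0 the string has N = c + 2 p, so c + p <= N and the member
    u (c + p) is nonzero; its weight is b + p a - (c + p) a = b - c a. *)
Lemma root_reflection_nat a b h (c : nat) : is_coroot a h -> is_root b ->
  b h = c%:R -> is_root (b - b h *: a).
Proof.
move=> ah [b0 [v v0 bv]] bh; split.
  apply: contra_neq b0 => bE.
  have := congr1 (fun f : lie_dual H => f h) bE.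
  rewrite add_lfunE opp_lfunE scale_lfunE zero_lfunE (proj2 ah) bh => /eqP.
  rewrite -[X in X - _]mulr1 -[X in _ - X]/(c%:R * 2) -mulrBr mulf_eq0.
  rewrite subr_eq0 (eqr_nat _ 1 2) orbF => /eqP c0.
  by move: bE; rewrite bh c0 scale0r subr0.
have [x [p [N [u [_ cN bu u0 _]]]]] := root_string ah v0 bv.
have {}cN : (c + 2 * p)%N = N.
  by apply/eqP; rewrite -(eqr_nat K) natrD natrM -bh cN.
exists (u (c + p)%N).
  by apply: u0; rewrite -cN mul2n -addnn addnA leq_addr.
have := bu (c + p)%N; rewrite mulrnDr opprD addrA addrAC addrK bh.
by rewrite scaler_nat.
Qed.

(** A negative b(h) reduces to the previous case by exchanging the roles of x
    and y, that is, replacing a, h by -a, -h. *)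
Lemma root_reflection a b h :
  is_coroot a h -> is_root b -> is_root (b - b h *: a).
Proof.
move=> ah rb; have [[c|c] bh] := root_coroot_int ah rb.
  exact: (root_reflection_nat ah rb bh).
have := root_reflection_nat (c := c.+1) (is_corootN ah) rb.
rewrite linearN /= scalerN scaleNr opprK; apply.
by rewrite bh NegzE mulrNz opprK.
Qed.

(** The string through a root vector of weight (k+2) a passes through weight 0,
    where its member t lies in H.  Then [x, t] is a multiple of x, and is killed
    by ad x.  But [x, [x, t]] is a nonzero multiple of the string member of
    weight 2 a, which is nonzero. *)
Lemma root_not_multiple a h k : is_coroot a h -> ~ is_root (a *+ k.+2).
Proof.
move=> ah [_ [v v0 bv]].
have [x [p [N [u [ax cN bu u0 xu]]]]] := root_string ah v0 bv.
have {}cN : (2 * (k + p).+2)%N = N.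
  apply/eqP; rewrite -(eqr_nat K) -cN -scaler_nat scale_lfunE (proj2 ah).
  rewrite -[_ *: _]/(k.+2%:R * 2 : K) -natrM -natrM -natrD eqr_nat; lia.
set q := (k + p)%N in cN.
have tH : u q.+2 \in H.
  by apply: root_space0; have := bu q.+2; rewrite -mulrnDr !addSn subrr.
have : bracket x (bracket x (u q.+2)) = 0.
  by rewrite [bracket x (u _)]bracketC (ax (Subvs tH)) bracketNr bracketZr
             bracket_alt scaler0 oppr0.
rewrite xu bracketZr xu !scalerA => /eqP; apply/negP.
rewrite scaler_eq0 !mulf_eq0 !pnatr_eq0 /= !subr_eq0 !eqr_nat.
rewrite (negPf (u0 q _)) -cN ?orbF; last by lia.
by rewrite negb_or; apply/andP; split; lia.
Qed.

(** A root is determined by its values on a basis of H, and each value is an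
    eigenvalue of the corresponding ad-diagonalizable element. *)
Lemma finite_roots : finite_set [set b : lie_dual H | is_root b]%classic.
Proof.
pose d := \dim (fullv : {vspace subvs_of H}).
pose e (i : 'I_d) : subvs_of H := (vbasis fullv)`_i.
have /choice[E EP] : forall i, exists E : seq K, forall c v, v != 0 ->
    bracket (vsval (e i)) v = c *: v -> c \in E.
  by move=> i; apply/eigenvalues_finite/(cartan_diag H_cartan)/subvsP.
pose EE := flatten [seq E i | i : 'I_d].
pose G (f : {ffun 'I_d -> seq_sub EE}) : lie_dual H :=
  xget 0 [set b : lie_dual H | forall i, b (e i) = ssval (f i)]%classic.
apply: (@sub_finite_set _ _ (range G)); last exact/finite_image/finite_finset.
move=> b [_ [v v0 bv]].
have bE i : (b (e i) : K) \in EE.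
  apply/flattenP; exists (E i); first by rewrite map_f ?mem_enum.
  by apply: (EP i _ v v0); rewrite bv.
exists [ffun i => SeqSub (bE i)] => //; rewrite /G; case: xgetP => [f _ fP|noG].
  apply/lfunP => h; rewrite (coord_vbasis (memvf h)) !linear_sum.
  by apply: eq_bigr => i _; rewrite !linearZ /= fP ffunE.
by case: (noG b) => i; rewrite ffunE.
Qed.

End RootSpaces.

(** * Reflections in a Euclidean space *)

Section Reflections.
Context (R : realType) (n : nat) (ip : 'cV[R]_n -> 'cV[R]_n -> R).
Hypothesis ip_inner : inner_product ip.
Local Notation e i := (e_ R i).
Implicit Types (i j : 'I_n) (a u v : 'cV[R]_n) (g : 'M[R]_n).

Lemma ipDl u v a : ip (u + v) a = ip u a + ip v a.
Proof. by rewrite -[u]scale1r (ip_linear ip_inner) mul1r scale1r. Qed.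

Lemma ip0l a : ip 0 a = 0.
Proof. by apply: (addrI (ip 0 a)); rewrite -ipDl !addr0. Qed.

Lemma ipZl c u a : ip (c *: u) a = c * ip u a.
Proof. by rewrite -[c *: u]addr0 (ip_linear ip_inner) ip0l addr0. Qed.

Lemma ipNl u a : ip (- u) a = - ip u a.
Proof. by rewrite -scaleN1r ipZl mulN1r. Qed.

Lemma ip_suml (I : Type) (r : seq I) (F : I -> 'cV[R]_n) a :
  ip (\sum_(i <- r) F i) a = \sum_(i <- r) ip (F i) a.
Proof. exact: (big_morph _ (fun u v => ipDl u v a) (ip0l a)). Qed.

Lemma ipDr u v a : ip a (u + v) = ip a u + ip a v.
Proof. by rewrite ip_sym // ipDl !(ip_sym ip_inner a). Qed.

Lemma ipZr c u a : ip a (c *: u) = c * ip a u.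
Proof. by rewrite ip_sym // ipZl (ip_sym ip_inner a). Qed.

Lemma ipNr u a : ip a (- u) = - ip a u.
Proof. by rewrite ip_sym // ipNl (ip_sym ip_inner a). Qed.

Lemma col_sum_e v : v = \sum_i v i 0 *: e i.
Proof.
apply/colP => k; rewrite summxE (bigD1 k) //= big1 => [|i ik].
  by rewrite !mxE !eqxx mulr1 addr0.
by rewrite !mxE eq_sym (negPf ik) mulr0.
Qed.

Lemma e_neq0 i : e i != 0.
Proof.
by apply/eqP => /colP/(_ i)/eqP; rewrite !mxE !eqxx oner_eq0.
Qed.

Lemma e_gt0 i : 0 < ip (e i) (e i).
Proof. exact/(ip_pos ip_inner)/e_neq0. Qed.

Lemma eq_mx_mulcV g g' : (forall v, g *m v = g' *m v) -> g = g'.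
Proof.
move=> gg'; apply/matrixP => i j.
by have := congr1 (fun v => v i 0) (gg' (e j)); rewrite -!colE !mxE.
Qed.

Lemma reflectionE a v :
  reflection_mx ip a *m v = v - (2 * ip v a / ip a a) *: a.
Proof.
rewrite [in RHS](col_sum_e v) ip_suml; apply/colP => k.
rewrite !mxE summxE mulr_sumr !mulr_suml -sumrB; apply: eq_bigr => j _.
rewrite ipZl !mxE; ring.
Qed.

Lemma reflection_isometry a u v : a != 0 ->
  ip (reflection_mx ip a *m u) (reflection_mx ip a *m v) = ip u v.
Proof.
move=> /(ip_pos ip_inner) a0; rewrite !reflectionE -!scaleNr.
rewrite !ipDl !ipDr !ipZl !ipZr (ip_sym ip_inner a v).
by field; rewrite gt_eqF.
Qed.

Lemma reflectionK a v : a != 0 ->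
  reflection_mx ip a *m (reflection_mx ip a *m v) = v.
Proof.
move=> /(ip_pos ip_inner) a0; rewrite !reflectionE -!scaleNr ipDl ipZl.
rewrite -addrA -scalerDl [X in X *: _](_ : _ = 0) ?scale0r ?addr0 //.
by field; rewrite gt_eqF.
Qed.

Lemma reflection_mulK a : a != 0 ->
  reflection_mx ip a *m reflection_mx ip a = 1%:M.
Proof.
by move=> a0; apply: eq_mx_mulcV => v; rewrite -mulmxA reflectionK // mul1mx.
Qed.

Lemma reflectionN a : reflection_mx ip (- a) = reflection_mx ip a.
Proof.
apply: eq_mx_mulcV => v; rewrite !reflectionE !ipNr ipNl opprK.
by rewrite mulrN mulNr scaleNr scalerN opprK.
Qed.

Lemma reflection_conj g a : (forall u v, ip (g *m u) (g *m v) = ip u v) ->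
  reflection_mx ip (g *m a) *m g = g *m reflection_mx ip a.
Proof.
move=> g_iso; apply: eq_mx_mulcV => v.
by rewrite -!mulmxA !reflectionE !g_iso mulmxBr -scalemxAr.
Qed.

(** The value of the simple coroot alpha_i^vee at v, which is also the i-th
    coordinate of A v. *)
Definition cartan_pairing i v : R := 2 * ip v (e i) / ip (e i) (e i).

Lemma simple_reflectionE i v :
  simple_reflection ip i *m v = v - cartan_pairing i v *: e i.
Proof. exact: reflectionE. Qed.

Lemma simple_reflection_coord i j v : j != i ->
  (simple_reflection ip i *m v) j 0 = v j 0.
Proof.
move=> /negPf ji; rewrite simple_reflectionE !mxE.
by rewrite eq_sym [i == j]eq_sym ji mulr0 subr0.
Qed.

Lemma cartan_pairing_self i : cartan_pairing i (e i) = 2.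
Proof. by rewrite /cartan_pairing mulfK // gt_eqF // e_gt0. Qed.

Lemma cartan_pairingB i u v :
  cartan_pairing i (u - v) = cartan_pairing i u - cartan_pairing i v.
Proof. by rewrite /cartan_pairing ipDl ipNl mulrBr mulrBl. Qed.

Lemma cartan_pairingZ i c v :
  cartan_pairing i (c *: v) = c * cartan_pairing i v.
Proof. by rewrite /cartan_pairing ipZl mulrCA !mulrA. Qed.

Lemma simple_reflection_self i : simple_reflection ip i *m e i = - e i.
Proof.
rewrite simple_reflectionE cartan_pairing_self scaler_nat mulr2n.
by rewrite opprD addNKr.
Qed.

Lemma word_prod_cons i t :
  word_prod ip (i :: t) = simple_reflection ip i *m word_prod ip t.
Proof. by rewrite /word_prod big_cons. Qed.

Lemma word_prod_rcons i t :
  word_prod ip (rcons t i) = word_prod ip t *m simple_reflection ip i.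
Proof. by rewrite /word_prod -cats1 big_cat big_seq1. Qed.

(** Reversed words play the role of inverses, so that w^-1 never has to be
    formed as an inverse matrix. *)
Lemma word_prod_rev t : word_prod ip (rev t) *m word_prod ip t = 1%:M.
Proof.
elim: t => [|i t IHt]; first by rewrite /word_prod !big_nil mulmx1.
rewrite rev_cons word_prod_rcons word_prod_cons -mulmxA.
by rewrite (mulmxA (simple_reflection ip i)) reflection_mulK ?e_neq0 // mul1mx.
Qed.

Lemma word_prod_rev_eq t1 t2 : word_prod ip t1 = word_prod ip t2 ->
  word_prod ip (rev t1) = word_prod ip (rev t2).
Proof.
move=> t12; have := word_prod_rev (rev t2); rewrite revK -t12 => t1K.
by rewrite -[LHS]mulmx1 -t1K mulmxA word_prod_rev mul1mx.
Qed.

Lemma word_prod_isometry t u v :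
  ip (word_prod ip t *m u) (word_prod ip t *m v) = ip u v.
Proof.
elim: t => [|i t IHt]; first by rewrite /word_prod big_nil !mul1mx.
by rewrite word_prod_cons -!mulmxA reflection_isometry ?e_neq0.
Qed.

End Reflections.

(** * Root systems with a base, in coordinates *)

Section SimpleSystem.
Context (R : realType) (n : nat) (ip : 'cV[R]_n -> 'cV[R]_n -> R).
Hypothesis ip_inner : inner_product ip.
Local Notation e i := (e_ R i).

(** The part of the axioms of a reduced crystallographic root system with base
    e_1, ..., e_n that concerns simple reflections and simple roots.  Stability
    under all reflections follows, since these are words in the simple ones
    ([reflection_is_word]). *)
Record based_root_system (D : set 'cV[R]_n) : Prop := BasedRootSystem {
  brs_finite : finite_set D;
  brs_neq0 : forall v, D v -> v != 0;
  brs_simple : forall i, D (e i);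
  brs_sign : forall v, D v -> exists k : 'I_n -> nat,
    (forall i, v i 0 = (k i)%:R) \/ (forall i, v i 0 = - (k i)%:R);
  brs_multiple : forall i k, ~ D (e i *+ k.+2);
  brs_reflection : forall i v, D v -> D (simple_reflection ip i *m v);
  brs_int : forall i j, cartan_pairing ip i (e j) \is a Num.int
}.

Definition nonneg (v : 'cV[R]_n) := forall i, 0 <= v i 0.

Definition half_sum (D : set 'cV[R]_n) : 'cV[R]_n :=
  2^-1 *: \sum_(v \in [set v | D v /\ nonneg v]) v.

Context (D : set 'cV[R]_n).
Hypothesis D_brs : based_root_system D.
Implicit Types (i j : 'I_n) (a u v : 'cV[R]_n) (t : seq 'I_n).

Lemma nonneg_e i : nonneg (e i).
Proof. by move=> k; rewrite !mxE ler0n. Qed.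

Lemma root_nonneg_or_nonpos v : D v -> nonneg v \/ nonneg (- v).
Proof.
move=> /(brs_sign D_brs)[k [kP|kP]]; [left|right] => i.
  by rewrite kP.
by rewrite mxE kP opprK.
Qed.

Lemma nonneg_nonpos_eq0 v : nonneg v -> nonneg (- v) -> v = 0.
Proof.
move=> v0 nv0; apply/colP => i; rewrite [RHS]mxE; apply/eqP.
rewrite eq_le v0 andbT.
by have := nv0 i; rewrite mxE oppr_ge0.
Qed.

Lemma root_height v : D v -> nonneg v -> exists m : nat, \sum_i v i 0 = m%:R.
Proof.
move=> Dv v_ge0; have [k [kP|kP]] := brs_sign D_brs Dv.
  by exists (\sum_i k i)%N; rewrite natr_sum; apply: eq_bigr.
suff v0 : v = 0 by have := brs_neq0 D_brs Dv; rewrite v0 eqxx.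
by apply: nonneg_nonpos_eq0 => // i; rewrite mxE kP opprK.
Qed.

(** s_i changes only the i-th coordinate.  A positive root other than e_i has
    another nonzero coordinate, as no proper multiple of e_i is a root; this
    coordinate stays positive, and it fixes the sign of the image. *)
Lemma simple_reflection_nonneg i v : D v -> nonneg v -> v != e i ->
  nonneg (simple_reflection ip i *m v).
Proof.
move=> Dv v_ge0 vi.
have [j ji vj] : exists2 j, j != i & 0 < v j 0.
  apply: contrapT => no_j; case/eqP: vi.
  have vE : v = v i 0 *: e i.
    apply/colP => j; rewrite !mxE; case: (eqVneq j i) => [->|ji].
      by rewrite mulr1.
    rewrite mulr0; apply/eqP; rewrite eq_le v_ge0 andbT leNgt.
    by apply/negP => vj; apply: no_j; exists j.
  have [k [kP|kP]] := brs_sign D_brs Dv; last first.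
    have := brs_neq0 D_brs Dv; rewrite (nonneg_nonpos_eq0 v_ge0) ?eqxx // => j.
    by rewrite mxE kP opprK.
  rewrite kP in vE; case: (k i) vE => [|[|m]] vE.
  - by have := brs_neq0 D_brs Dv; rewrite vE scale0r eqxx.
  - by rewrite vE scale1r.
  - by case: (brs_multiple D_brs (i := i) (k := m)); rewrite -scaler_nat -vE.
have [//|/(_ j)] := root_nonneg_or_nonpos (brs_reflection D_brs i Dv).
by rewrite mxE simple_reflection_coord // oppr_ge0 leNgt vj.
Qed.

(** Induction on the height, the sum of the coordinates.  Since <a, a> > 0, some
    e_i has <a, e_i> > 0, and then s_i a is a positive root of smaller height
    unless a = e_i. *)
Lemma nonneg_root_conj a : D a -> nonneg a ->
  exists t i, a = word_prod ip t *m e i.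
Proof.
move=> Da a_ge0; have [m] := root_height Da a_ge0.
elim/ltn_ind: m a Da a_ge0 => m IHm a Da a_ge0 am.
have [[i ->]|a_simple] := pselect (exists i, a = e i).
  by exists [::], i; rewrite /word_prod big_nil mul1mx.
have [i ai] : exists i, 0 < ip a (e i).
  apply: contrapT => /forallNP a_le0.
  have := ip_pos ip_inner (brs_neq0 D_brs Da).
  rewrite {1}[a]col_sum_e ip_suml // ltNge => /negP; apply.
  apply: sumr_le0 => j _; rewrite ipZl // mulr_ge0_le0 //.
  by rewrite ip_sym // leNgt; apply/negP/a_le0.
have sa_ge0 : nonneg (simple_reflection ip i *m a).
  apply: simple_reflection_nonneg => //; apply/eqP => aE.
  by apply: a_simple; exists i.
have Dsa := brs_reflection D_brs i Da.
have [m' sam] := root_height Dsa sa_ge0.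
have m'm : (m' < m)%N.
  rewrite -(ltr_nat R) -am -sam (bigD1 i) //= [ltRHS](bigD1 i) //=.
  rewrite (eq_bigr (fun j => a j 0)) => [|j]; last first.
    exact: simple_reflection_coord.
  rewrite ltrD2r simple_reflectionE // !mxE !eqxx mulr1 gtrBl.
  by rewrite divr_gt0 ?mulr_gt0 // e_gt0.
have [t [j saE]] := IHm m' m'm _ Dsa sa_ge0 sam.
exists (i :: t), j; rewrite word_prod_cons -mulmxA -saE.
by rewrite reflectionK // e_neq0.
Qed.

End SimpleSystem.

(** * The group generated by all reflections *)

Section OppositeSystem.
Context (R : realType) (n : nat) (ip : 'cV[R]_n -> 'cV[R]_n -> R).
Hypothesis ip_inner : inner_product ip.
Context (D : set 'cV[R]_n).
Hypothesis D_brs : based_root_system ip D.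
Local Notation e i := (e_ R i).
Implicit Types (i j : 'I_n) (a u v : 'cV[R]_n) (t : seq 'I_n).

(** Passing to the opposite system allows [nonneg_root_conj] to be used for the
    negative roots as well. *)
Lemma based_root_systemN : based_root_system ip [set v | D (- v)]%classic.
Proof.
have De := brs_simple D_brs; have Ds := brs_reflection D_brs.
split=> [|v|i|v|i k|i v|]; last exact: brs_int D_brs.
- apply: sub_finite_set (finite_image (fun v => - v) (brs_finite D_brs)).
  by move=> v Dv; exists (- v); rewrite ?opprK.
- by move=> /(brs_neq0 D_brs); rewrite oppr_eq0.
- by rewrite /= -(simple_reflection_self ip_inner); apply: Ds.
- move=> /(brs_sign D_brs)[k [kP|kP]]; exists k; [right|left] => i;
  by apply: oppr_inj; have := kP i; rewrite mxE => ->; rewrite ?opprK.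
- move=> /= /(Ds i); rewrite mulmxN -scaler_nat -scalemxAr.
  rewrite simple_reflection_self // scalerN opprK scaler_nat.
  by move/(brs_multiple D_brs).
- by move=> /(Ds i); rewrite /= mulmxN.
Qed.

(** If a = g e_i up to sign, with g a word, then s_a = g s_i g^-1. *)
Lemma reflection_is_word a : D a ->
  exists t, reflection_mx ip a = word_prod ip t.
Proof.
have conj_word t i : exists t',
    reflection_mx ip (word_prod ip t *m e i) = word_prod ip t'.
  exists (t ++ i :: rev t); rewrite /word_prod big_cat big_cons /=.
  have := word_prod_rev ip_inner (rev t); rewrite revK => tK.
  rewrite -[LHS]mulmx1 -tK mulmxA (reflection_conj ip_inner); last first.
    exact: word_prod_isometry.
  by rewrite -mulmxA.
move=> Da; have [a_ge0|a_le0] := root_nonneg_or_nonpos D_brs Da.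
  by have [t [i ->]] := nonneg_root_conj ip_inner D_brs Da a_ge0.
have DNa : D (- - a) by rewrite opprK.
have [t [i aE]] := nonneg_root_conj ip_inner based_root_systemN DNa a_le0.
by rewrite -reflectionN // aE.
Qed.

End OppositeSystem.

(** * The half-sum of the positive roots and the exchange property *)

Section WeylGroup.
Context (R : realType) (n : nat) (ip : 'cV[R]_n -> 'cV[R]_n -> R).
Hypothesis ip_inner : inner_product ip.
Context (D : set 'cV[R]_n).
Hypothesis D_brs : based_root_system ip D.
Local Notation e i := (e_ R i).
Implicit Types (i j : 'I_n) (a u v : 'cV[R]_n) (t : seq 'I_n).

(** s_i permutes the positive roots other than e_i and negates e_i, so it lowers
    the full sum by 2 e_i. *)
Lemma simple_reflection_half_sum i :
  simple_reflection ip i *m half_sum D = half_sum D - e i.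
Proof.
rewrite /half_sum; set P := [set v | _]%classic.
have /finite_seqP[s0 s0P] : finite_set P.
  by apply: sub_finite_set (brs_finite D_brs) => v [].
have [s s_uniq sP] : exists2 s, uniq s & P = [set` s]%classic.
  exists (undup s0); first exact: undup_uniq.
  by rewrite s0P; apply/seteqP; split => v /=; rewrite mem_undup.
rewrite sP -fsbig_seq //.
have s_in v : v \in s <-> D v /\ nonneg v.
  have -> : (D v /\ nonneg v) = P v by [].
  by rewrite sP.
have ei_s : e i \in s.
  by apply/s_in; split; [apply: (brs_simple D_brs) | apply: nonneg_e].
have r_uniq := rem_uniq (e i) s_uniq.
have r_in v : v \in rem (e i) s <-> [/\ v != e i, D v & nonneg v].
  rewrite mem_rem_uniq // inE; split.
    by move=> /andP[vi /s_in[Dv v0]].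
  by move=> [vi Dv v0]; rewrite vi; apply/s_in.
set f := fun v => simple_reflection ip i *m v.
have fK : cancel f f by move=> v; rewrite /f reflectionK // e_neq0.
have r_perm : perm_eq [seq f v | v <- rem (e i) s] (rem (e i) s).
  have f_uniq : uniq [seq f v | v <- rem (e i) s].
    by rewrite (map_inj_uniq (can_inj fK)).
  have [] := uniq_min_size f_uniq (s2 := rem (e i) s).
  - move=> _ /mapP[v /r_in[vi Dv v0] ->]; apply/r_in; split.
    + apply: contra_neq (e_neq0 R i) => fv.
      have := v0; rewrite -[v]fK fv /f simple_reflection_self // => ei_le0.
      exact: nonneg_nonpos_eq0 (nonneg_e R i) ei_le0.
    + exact: (brs_reflection D_brs).
    + exact: (simple_reflection_nonneg ip_inner D_brs).
  - by rewrite size_map.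
  - by move=> _ eq_mem; apply: uniq_perm.
rewrite (perm_big _ (perm_to_rem ei_s)) /= big_cons -scalemxAr mulmxDr.
rewrite simple_reflection_self // mulmx_sumr.
rewrite -(big_map f xpredT id) (perm_big _ r_perm) /=.
by apply/colP => k; rewrite !mxE; field.
Qed.

Lemma cartan_pairing_half_sum i : cartan_pairing ip i (half_sum D) = 1.
Proof.
have := simple_reflection_half_sum i; rewrite simple_reflectionE //.
move=> /addrI/oppr_inj/colP/(_ i).
by rewrite !mxE !eqxx !mulr1.
Qed.

(** The pairings with the simple coroots being 1, <e_i, delta> = <e_i, e_i> / 2
    is positive for every i. *)
Lemma ip_half_sum_gt0 v : nonneg v -> v != 0 -> 0 < ip v (half_sum D).
Proof.
move=> v_ge0 v0; rewrite [v]col_sum_e ip_suml //.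
have ei_gt0 i : 0 < ip (e i) (half_sum D).
  have := cartan_pairing_half_sum i; rewrite /cartan_pairing ip_sym // => ei1.
  have e0 := e_gt0 ip_inner i.
  have -> : ip (e i) (half_sum D) = ip (e i) (e i) / 2.
    by apply: (mulfI (x := 2 / ip (e i) (e i)));
      rewrite ?mulf_neq0 ?invr_eq0 ?gt_eqF // mulrAC ei1; field; rewrite gt_eqF.
  by rewrite divr_gt0.
have [i vi] : exists i, v i 0 != 0.
  apply/existsP; apply: contraNT v0 => /existsPn v_i; apply/eqP/colP => i.
  by rewrite mxE; apply/eqP; have := v_i i; rewrite negbK.
rewrite (bigD1 i) //= ltr_pwDl ?sumr_ge0 // => [|j _]; rewrite ipZl //.
  by rewrite mulr_gt0 // lt_neqAle eq_sym vi v_ge0.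
by rewrite mulr_ge0 // ltW.
Qed.

Lemma weyl_group_word w : weyl_group ip D w -> exists t, w = word_prod ip t.
Proof.
case=> s [sD ->]; elim: s sD => [|a s IHs] sD.
  by exists [::]; rewrite big_nil /word_prod big_nil.
have [t1 aE] := reflection_is_word ip_inner D_brs (sD a (mem_head _ _)).
have [|t2 sE] := IHs; first by move=> x xs; apply: sD; rewrite inE xs orbT.
by exists (t1 ++ t2); rewrite big_cons aE sE /word_prod big_cat.
Qed.

Lemma word_prod_root t v : D v -> D (word_prod ip t *m v).
Proof.
move=> Dv; elim: t => [|i t IHt]; first by rewrite /word_prod big_nil mul1mx.
by rewrite word_prod_cons -mulmxA; apply: (brs_reflection D_brs).
Qed.

(** Induction on the word t j from the right.  If t^-1 e_i is already negative,
    the erased letter is in t.  Otherwise s_j makes the positive root t^-1 e_i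
    negative, so t^-1 e_i = e_j and s_i t = t s_j: the last letter is erased. *)
Lemma exchange i t : nonneg (- (word_prod ip (rev t) *m e i)) ->
  exists2 t', size t = (size t').+1
            & simple_reflection ip i *m word_prod ip t = word_prod ip t'.
Proof.
elim/last_ind: t => [|t j IHt].
  rewrite /word_prod big_nil mul1mx => ei_le0.
  by have := e_neq0 R i; rewrite (nonneg_nonpos_eq0 (nonneg_e R i) ei_le0) eqxx.
rewrite rev_rcons word_prod_cons -mulmxA => sjv_le0.
have Dv := word_prod_root (rev t) (brs_simple D_brs i).
have [v_ge0|/IHt[t' t'_size t'E]] := root_nonneg_or_nonpos D_brs Dv; last first.
  exists (rcons t' j); first by rewrite !size_rcons t'_size.
  by rewrite !word_prod_rcons mulmxA t'E.
exists t; first by rewrite size_rcons.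
have vE : word_prod ip (rev t) *m e i = e j.
  apply/eqP; apply: contraT => vj.
  have sjv_ge0 := simple_reflection_nonneg ip_inner D_brs Dv v_ge0 vj.
  have := brs_neq0 D_brs (brs_reflection D_brs j Dv).
  by rewrite (nonneg_nonpos_eq0 sjv_ge0 sjv_le0) eqxx.
have eiE : e i = word_prod ip t *m e j.
  have := word_prod_rev ip_inner (rev t); rewrite revK => tK.
  by rewrite -vE mulmxA tK mul1mx.
rewrite word_prod_rcons {1}/simple_reflection eiE mulmxA.
rewrite (reflection_conj ip_inner); last exact: word_prod_isometry.
by rewrite -mulmxA reflection_mulK ?e_neq0 // mulmx1.
Qed.

Lemma reduced_expression_exists t :
  exists t', reduced_expression ip (word_prod ip t) t'.
Proof.
pose P m := `[< exists2 t', word_prod ip t = word_prod ip t' & size t' = m >].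
have exP : exists m, P m by exists (size t); apply/asboolP; exists t.
case: (ex_minnP exP) => m /asboolP[t' tE <-] t'_min.
exists t'; split => // t2 t2E.
by apply: t'_min; apply/asboolP; exists t2.
Qed.

(** If w^-1 e_i < 0, erasing a letter of a reduced word of w gives a shorter
    word of s_i w, to which s_i is prepended.  Conversely, if w = s_i w' with
    this word reduced and w^-1 e_i > 0, then w'^-1 e_i = - w^-1 e_i < 0 and the
    exchange property makes w = s_i w' shorter. *)
Lemma left_descentP i t : nonneg (- (word_prod ip (rev t) *m e i)) <->
  exists t', reduced_expression ip (word_prod ip t) (i :: t').
Proof.
split=> [v_le0|[t' [tE t'_min]]].
  have [t2 [tE t2_min]] := reduced_expression_exists t.
  have t_inv : word_prod ip (rev t) = word_prod ip (rev t2).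
    exact: word_prod_rev_eq.
  rewrite t_inv in v_le0; have [t3 t3_size t3E] := exchange v_le0.
  exists t3; split=> [|t4 /t2_min]; last by rewrite t3_size.
  rewrite word_prod_cons -t3E mulmxA.
  by rewrite reflection_mulK ?e_neq0 // mul1mx.
have Dv := word_prod_root (rev t) (brs_simple D_brs i).
have [v_ge0|//] := root_nonneg_or_nonpos D_brs Dv.
have t_inv : word_prod ip (rev t) = word_prod ip (rev (i :: t')).
  exact: word_prod_rev_eq.
have [|t2 t2_size t2E] := @exchange i t'.
  move: v_ge0; rewrite t_inv rev_cons word_prod_rcons -mulmxA.
  by rewrite simple_reflection_self // mulmxN.
have := t'_min t2; rewrite tE word_prod_cons t2E /= t2_size => /(_ erefl).
by rewrite ltnNge -ltnS leqnSn.
Qed.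

Lemma cartan_pairing_word_int i t v :
  (forall j, cartan_pairing ip j v \is a Num.int) ->
  cartan_pairing ip i (word_prod ip t *m v) \is a Num.int.
Proof.
move=> v_int; elim: t i => [|j t IHt] i.
  by rewrite /word_prod big_nil mul1mx.
rewrite word_prod_cons -mulmxA simple_reflectionE // cartan_pairingB //.
by rewrite cartan_pairingZ // rpredB // rpredM // (brs_int D_brs).
Qed.

(** The pairing is a positive multiple of <e_i, w delta> = <w^-1 e_i, delta>. *)
Lemma cartan_pairing_word_sign i t :
  let b := cartan_pairing ip i (word_prod ip t *m half_sum D) in
  b != 0 /\ (b < 0 <-> nonneg (- (word_prod ip (rev t) *m e i))).
Proof.
set v := word_prod ip (rev t) *m e i => b.
have bE : b = 2 / ip (e i) (e i) * ip v (half_sum D).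
  rewrite /b /cartan_pairing ip_sym //.
  rewrite -(word_prod_isometry ip_inner (rev t)) mulmxA word_prod_rev // mul1mx.
  by rewrite mulrAC.
have c_gt0 : 0 < 2 / ip (e i) (e i) by rewrite divr_gt0 // e_gt0.
have Dv : D v := word_prod_root (rev t) (brs_simple D_brs i).
have v0 := brs_neq0 D_brs Dv.
have [v_ge0|v_le0] := root_nonneg_or_nonpos D_brs Dv.
  have b_gt0 : 0 < b by rewrite bE mulr_gt0 // ip_half_sum_gt0.
  split; first by rewrite gt_eqF.
  split=> [|v_le0]; first by rewrite ltNge ltW.
  by rewrite (nonneg_nonpos_eq0 v_ge0 v_le0) eqxx in v0.
have b_lt0 : b < 0.
  by rewrite bE pmulr_rlt0 // -oppr_gt0 -ipNl // ip_half_sum_gt0 // oppr_eq0.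
by split; first by rewrite lt_eqF.
Qed.

End WeylGroup.

(** * The roots of the Lie algebra in simple coordinates *)

Section RootCoordinates.
Context (R : realType) (n : nat) (L : lieAlgebra R[i]) (H : {vspace L}).
Context (alpha : 'I_n -> lie_dual H) (A : 'M[R]_n).
Context (ip : 'cV[R]_n -> 'cV[R]_n -> R).
Hypothesis H_cartan : cartan_subalgebra H.
Hypothesis alpha_simple : simple_roots alpha.
Hypothesis A_cartan : cartan_matrix alpha (map_mx (fun x : R => x%:C) A).
Hypothesis ip_inner : inner_product ip.
Hypothesis ip_A : forall i j : 'I_n,
  2 * ip (e_ R i) (e_ R j) / ip (e_ R i) (e_ R i) = A i j.
Local Notation e i := (e_ R i).
Implicit Types (i j : 'I_n) (u v : 'cV[R]_n).

(** The identification of R^n with the real span of the roots. *)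
Definition functional_of v : lie_dual H := \sum_i (v i 0)%:C *: alpha i.

Lemma functional_of_inj : injective functional_of.
Proof.
have [al_basis _ _] := alpha_simple.
have al_free : free [tuple alpha i | i < n] := basis_free al_basis.
move=> u v uv; apply/colP => i; apply: complexI.
have coordE (w : 'cV[R]_n) :
    (w i 0)%:C = coord [tuple alpha i | i < n] i (functional_of w).
  rewrite -[LHS](coord_sum_free (fun j => (w j 0)%:C) i al_free).
  by congr (coord _ _ _); apply: eq_bigr => j _; rewrite -tnth_nth tnth_mktuple.
by rewrite !coordE uv.
Qed.

Lemma functional_ofN v : functional_of (- v) = - functional_of v.
Proof.
rewrite /functional_of -sumrN; apply: eq_bigr => i _.
by rewrite !mxE rmorphN scaleNr.
Qed.

Lemma functional_ofB u v :
  functional_of (u - v) = functional_of u - functional_of v.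
Proof.
rewrite /functional_of -sumrB; apply: eq_bigr => i _.
by rewrite !mxE rmorphB scalerBl.
Qed.

Lemma functional_ofZ c v : functional_of (c *: v) = c%:C *: functional_of v.
Proof.
rewrite /functional_of scaler_sumr; apply: eq_bigr => i _.
by rewrite !mxE rmorphM scalerA.
Qed.

Lemma functional_of_e i : functional_of (e i) = alpha i.
Proof.
rewrite /functional_of (bigD1 i) //= big1 => [|j ji].
  by rewrite !mxE !eqxx scale1r addr0.
by rewrite !mxE (negPf ji) scale0r.
Qed.

Lemma cartan_pairing_mulmx i v : cartan_pairing ip i v = (A *m v) i 0.
Proof.
rewrite /cartan_pairing [in LHS](col_sum_e v) ip_suml // mulr_sumr mulr_suml.
rewrite mxE; apply: eq_bigr => j _.
by rewrite ipZl // -ip_A (ip_sym ip_inner (e j)); ring.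
Qed.

(** Under the identification, s_i becomes b |-> b - b(h_i) alpha_i, because the
    pairing with alpha_i^vee is evaluation at the coroot h_i. *)
Lemma root_set_based : based_root_system ip (root_set alpha).
Proof.
have [_ al_root al_sign] := alpha_simple; have [h [h_coroot Ah]] := A_cartan.
have {}Ah i j : (A i j)%:C = alpha j (h i) by rewrite -Ah mxE.
split=> [|v v_root|i|v v_root|i k|i v v_root|i j].
- apply: finite_preimage (finite_roots H_cartan).
  by move=> u v _ _; apply: functional_of_inj.
- apply: contraTneq isT => v0; case: v_root => /eqP; case.
  by rewrite v0 big1 // => i _; rewrite mxE scale0r.
- by rewrite /root_set /= -/(functional_of _) functional_of_e.
- have [k vk] := al_sign _ v_root; exists k.
  have kE : \sum_i alpha i *+ k i = functional_of (\col_i (k i)%:R).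
    by apply: eq_bigr => i _; rewrite mxE rmorph_nat scaler_nat.
  case: vk => vk; [left|right] => i.
    have -> : v = \col_i (k i)%:R by apply: functional_of_inj; rewrite -kE.
    by rewrite mxE.
  have -> : v = - \col_i (k i)%:R.
    by apply: functional_of_inj; rewrite functional_ofN -kE.
  by rewrite !mxE.
- rewrite /root_set /= -/(functional_of _) -scaler_nat functional_ofZ.
  rewrite functional_of_e rmorph_nat scaler_nat.
  exact: (root_not_multiple H_cartan (h_coroot i)).
- rewrite /root_set /= -/(functional_of _) simple_reflectionE // functional_ofB.
  rewrite functional_ofZ functional_of_e.
  have -> : (cartan_pairing ip i v)%:C = functional_of v (h i).
    rewrite cartan_pairing_mulmx mxE rmorph_sum sum_lfunE.
    apply: eq_bigr => j _.
    by rewrite scale_lfunE -Ah mulrC rmorphM.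
  exact: root_reflection.
- have [z Az] := root_coroot_int H_cartan (h_coroot i) (al_root j).
  rewrite cartan_pairing_mulmx [e j]/e_ -colE mxE.
  apply/intrP; exists z; apply: complexI.
  by rewrite Ah Az rmorph_int.
Qed.

End RootCoordinates.

Theorem theorem4p2 (R : realType) (n : nat)
    (L : lieAlgebra R[i]) (L_semisimple : semisimple L)
    (H : {vspace L}) (H_cartan : cartan_subalgebra H)
    (rank_L : \dim H = n)
    (alpha : 'I_n -> lie_dual H) (alpha_simple : simple_roots alpha)
    (A : 'M[R]_n)
    (A_cartan : cartan_matrix alpha (map_mx (fun x : R => x%:C) A))
    (ip : 'cV[R]_n -> 'cV[R]_n -> R) (ip_inner : inner_product ip)
    (ip_A : forall i j : 'I_n,
      2 * ip (e_ R i) (e_ R j) / ip (e_ R i) (e_ R i) = A i j)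
    (w : 'M[R]_n) (w_weyl : weyl_group ip (root_set alpha) w) :
  let b : 'cV[R]_n := A *m w *m half_sum_positive_roots alpha in
  (forall i : 'I_n, b i 0 \is a Num.int /\ b i 0 != 0) /\
  (forall i : 'I_n,
     b i 0 < 0 <-> exists t : seq 'I_n, reduced_expression ip w (i :: t)).
Proof.
have brs := root_set_based H_cartan alpha_simple A_cartan ip_inner ip_A.
have [t ->] := weyl_group_word ip_inner brs w_weyl.
move=> b.
have bE i :
    b i 0 = cartan_pairing ip i (word_prod ip t *m half_sum (root_set alpha)).
  by rewrite (cartan_pairing_mulmx ip_inner ip_A) mulmxA.
split=> i; rewrite bE;
  have [b0 b_lt0] := cartan_pairing_word_sign ip_inner brs i t.
  split=> //; apply: (cartan_pairing_word_int ip_inner brs) => j.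
  by rewrite (cartan_pairing_half_sum ip_inner brs) rpred1.
exact: iff_trans b_lt0 (left_descentP ip_inner brs i t).
Qed.
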